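(* Let $m_0>0$, and let $S_j=m_0 j$ and $d_j=2^{-j}$ for all integers $j\ge 0$. Let $F:\mathbb{R}\to\mathbb{R}$ be the function built from $(S_j)$ and $(d_j)$ as described in the context. Let $\theta_0=0$, $\theta_1=\theta_0-m_0\dot F(\theta_0)$, and (Barzilai–Borwein method) $$\theta_{k+1}=\theta_k-\frac{\theta_k-\theta_{k-1}}{\dot F(\theta_k)-\dot F(\theta_{k-1})}\,\dot F(\theta_k),\qquad k=1,2,\dots.$$ Then $\lim_{k\to\infty}F(\theta_k)=\infty$.
   Context: $\dot F$ denotes the derivative of $F$. For $m>0$ and $d,\delta\in(0,1]$ let $f(\cdot\,;m,d,\delta):[0,m]\to\mathbb{R}$ be given by $$f(\theta;m,d,\delta)=\begin{cases} -d\theta & \theta\in(0,\frac{2-d}{16}m)\\ \frac{8}{m}(\theta-\frac m8)^2-m\frac{-d^2+4d}{32} & \theta\in[\frac{2-d}{16}m,\frac{3}{16}m)\\ -\frac{5m}{16}\exp\left(\frac{5/16}{\theta/m-1/2}+1\right)+m\frac{11+d^2-4d}{32} & \theta\in(\frac{3}{16}m,\frac12 m)\\ m\frac{11+d^2-4d}{32} & \theta=\frac12 m\\ \frac{5m}{16}\exp\left(\frac{-5/16}{\theta/m-1/2}+1\right)+m\frac{11+d^2-4d}{32} & \theta\in(\frac12 m,\frac{13}{16}m)\\ -\frac{8}{m}(\theta-\frac{7m}{8})^2+m\frac{22+d^2-4d}{32} & \theta\in[\frac{13}{16}m,\frac{\delta+14}{16}m)\\ -\delta\theta+m\frac{22+d^2+\delta^2-4d+28\delta}{32}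 & \theta\in[\frac{\delta+14}{16}m,m] \end{cases}$$ and extended to $\theta=0$ and $\theta=\frac{3}{16}m$ by continuity. Given a strictly increasing real sequence $(S_j)_{j\ge0}$ and a sequence $(d_j)_{j\ge 0}$ in $(0,1]$, the function $F$ is defined (recursively in $j$) on $(-\infty,\sup_j S_j)$ by $F(\theta)=-d_0(\theta-S_0)$ for $\theta\le S_0$; $F(\theta)=f(\theta-S_0;S_1-S_0,d_0,d_1)$ for $\theta\in(S_0,S_1]$; and $F(\theta)=f(\theta-S_j;S_{j+1}-S_j,d_j,d_{j+1})+F(S_j)$ for $\theta\in(S_j,S_{j+1}]$, $j=1,2,\dots$. It is defined on all of $\mathbb{R}$ when $\sup_j S_j=\infty$. *)

(* Defs.v *)
From Stdlib Require Import Reals Lra Lia ClassicalEpsilon.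
From Coquelicot Require Import Coquelicot.
Open Scope R_scope.

(* Meaningful for theta in [0, m], with 0 < m and d, delta in (0, 1].  The first
   two pieces are closed up at theta = 0 and theta = 3m/16; [f_right_continuous_0]
   and [f_continuous_3_16] show that this is the extension by continuity. *)
Definition f (m d delta theta : R) : R :=
  if Rlt_dec theta ((2 - d) / 16 * m) then
    - d * theta
  else if Rle_dec theta (3 / 16 * m) then
    8 / m * (theta - m / 8) ^ 2 - m * ((- d ^ 2 + 4 * d) / 32)
  else if Rlt_dec theta (1 / 2 * m) then
    - (5 * m / 16) * exp ((5 / 16) / (theta / m - 1 / 2) + 1)
    + m * ((11 + d ^ 2 - 4 * d) / 32)
  else if Rle_dec theta (1 / 2 * m) then
    m * ((11 + d ^ 2 - 4 * d) / 32)
  else if Rlt_dec theta (13 / 16 * m) then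
    5 * m / 16 * exp (- (5 / 16) / (theta / m - 1 / 2) + 1)
    + m * ((11 + d ^ 2 - 4 * d) / 32)
  else if Rlt_dec theta ((delta + 14) / 16 * m) then
    - (8 / m) * (theta - 7 * m / 8) ^ 2 + m * ((22 + d ^ 2 - 4 * d) / 32)
  else
    - delta * theta
    + m * ((22 + d ^ 2 + delta ^ 2 - 4 * d + 28 * delta) / 32).

(* [F] is built from the knots [s] and the slopes [d]; nothing is required of [F]
   beyond [sup_j s j]. *)
Record is_F (s d : nat -> R) (F : R -> R) : Prop := {
  is_F_left : forall theta, theta <= s 0%nat ->
    F theta = - d 0%nat * (theta - s 0%nat);
  is_F_first : forall theta, s 0%nat < theta <= s 1%nat ->
    F theta = f (s 1%nat - s 0%nat) (d 0%nat) (d 1%nat) (theta - s 0%nat);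
  is_F_next : forall j, (1 <= j)%nat ->
    forall theta, s j < theta <= s (S j) ->
    F theta = f (s (S j) - s j) (d j) (d (S j)) (theta - s j) + F (s j)
}.

Lemma continuous_ex_derive (g : R -> R) (x : R) :
  ex_derive g x -> continuous g x.
Proof. exact (ex_derive_continuous g x). Qed.

Lemma f_right_continuous_0 (m d delta : R) :
  0 < m -> 0 < d <= 1 ->
  filterlim (f m d delta) (at_right 0) (locally (f m d delta 0)).
Proof.
intros Hm Hd.
assert (Hp : 0 < (2 - d) / 16 * m) by (apply Rmult_lt_0_compat; lra).
assert (H0 : f m d delta 0 = - d * 0)
  by (unfold f; destruct (Rlt_dec 0 _); [reflexivity | lra]).
rewrite H0.
apply (filterlim_ext_loc (fun x => - d * x)).
- exists (mkposreal _ Hp); intros y Hy Hy0; unfold f.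
  destruct (Rlt_dec y _) as [|n]; [reflexivity | exfalso; apply n].
  change (Rabs (y - 0) < (2 - d) / 16 * m) in Hy.
  apply Rabs_lt_between in Hy; lra.
- assert (C : continuous (fun x : R => - d * x) 0)
    by (apply continuous_ex_derive; auto_derive; trivial).
  intros P HP; destruct (C P HP) as [e He].
  exists e; intros y Hy _; exact (He y Hy).
Qed.

Lemma continuous_glue (a : R) (h g1 g2 : R -> R) :
  continuous g1 a -> continuous g2 a -> g1 a = h a -> g2 a = h a ->
  locally a (fun x => h x = g1 x \/ h x = g2 x) -> continuous h a.
Proof.
intros C1 C2 E1 E2 L P HP.
assert (L1 : locally a (fun x => P (g1 x))) by (apply C1; rewrite E1; exact HP).
assert (L2 : locally a (fun x => P (g2 x))) by (apply C2; rewrite E2; exact HP).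
generalize (filter_and _ _ L (filter_and _ _ L1 L2)).
unfold filtermap; apply filter_imp; intros x [[E | E] [H1 H2]]; rewrite E; assumption.
Qed.

Lemma f_continuous_3_16 (m d delta : R) :
  0 < m -> 0 < d <= 1 -> continuous (f m d delta) (3 / 16 * m).
Proof.
intros Hm Hd.
assert (E : f m d delta (3 / 16 * m) = m * ((1 + d ^ 2 - 4 * d) / 32)).
{ unfold f.
  destruct (Rlt_dec _ _) as [l|_]; [exfalso; nra|].
  destruct (Rle_dec _ _) as [_|n]; [field; lra | lra]. }
assert (U : 3 / 16 * m / m - 1 / 2 = - (5 / 16)) by (field; lra).
apply (continuous_glue _ _
  (fun x => 8 / m * (x - m / 8) ^ 2 - m * ((- d ^ 2 + 4 * d) / 32))
  (fun x => - (5 * m / 16) * exp ((5 / 16) / (x / m - 1 / 2) + 1)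
            + m * ((11 + d ^ 2 - 4 * d) / 32))).
- apply continuous_ex_derive; auto_derive; trivial.
- apply continuous_ex_derive; auto_derive.
  change (3 / 16 * m / m - 1 / 2 <> 0); rewrite U; lra.
- rewrite E; field; lra.
- rewrite E, U.
  replace (5 / 16 / - (5 / 16) + 1) with 0 by field.
  rewrite exp_0; field.
- assert (Hp : 0 < d / 16 * m) by (apply Rmult_lt_0_compat; lra).
  assert (Hle : d / 16 * m <= 1 / 16 * m) by (apply Rmult_le_compat_r; lra).
  exists (mkposreal _ Hp); intros y Hy.
  change (Rabs (y - 3 / 16 * m) < d / 16 * m) in Hy.
  apply Rabs_lt_between in Hy; unfold f.
  destruct (Rlt_dec y ((2 - d) / 16 * m)); [exfalso; nra|].
  destruct (Rle_dec y (3 / 16 * m)); [left; reflexivity|].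
  destruct (Rlt_dec y (1 / 2 * m)); [right; reflexivity | lra].
Qed.

Fixpoint F_stage (s d : nat -> R) (n : nat) (theta : R) : R :=
  match n with
  | O => - d 0%nat * (theta - s 0%nat)
  | S j => if Rle_dec theta (s j) then F_stage s d j theta
           else f (s (S j) - s j) (d j) (d (S j)) (theta - s j)
                + F_stage s d j (s j)
  end.

Lemma F_stage_stable (s d : nat -> R) :
  (forall j, s j < s (S j)) ->
  forall theta n p, (n <= p)%nat -> theta <= s n ->
  F_stage s d p theta = F_stage s d n theta.
Proof.
intros Hs theta n p Hnp Hn.
assert (Hmono : theta <= s p /\ F_stage s d p theta = F_stage s d n theta).
{ induction Hnp as [|p Hnp [H1 H2]]; [auto|].
  split; [generalize (Hs p); lra|].
  simpl; destruct (Rle_dec theta (s p)); [assumption | lra]. }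
apply Hmono.
Qed.

Lemma is_F_exists (s d : nat -> R) :
  (forall j, s j < s (S j)) -> exists F, is_F s d F.
Proof.
intros Hs.
set (N := fun theta => epsilon (inhabits 0%nat) (fun n => theta <= s n)).
exists (fun theta => F_stage s d (N theta) theta).
assert (HF : forall n theta, theta <= s n ->
  F_stage s d (N theta) theta = F_stage s d n theta).
{ intros n theta Hn.
  assert (HN : theta <= s (N theta)) by (unfold N; apply epsilon_spec; eauto).
  destruct (Nat.le_ge_cases n (N theta)).
  - apply F_stage_stable; assumption.
  - symmetry; apply F_stage_stable; assumption. }
assert (Hstep : forall j theta, s j < theta <= s (S j) ->
  F_stage s d (N theta) theta
  = f (s (S j) - s j) (d j) (d (S j)) (theta - s j) + F_stage s d j (s j)).
{ intros j theta [H1 H2]; rewrite (HF (S j)) by assumption; simpl.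
  destruct (Rle_dec theta (s j)); [lra | reflexivity]. }
split.
- intros theta H; rewrite (HF 0%nat) by assumption; reflexivity.
- intros theta H; rewrite (Hstep 0%nat) by assumption; simpl; ring.
- intros j _ theta H; rewrite (Hstep j) by assumption.
  rewrite (HF j (s j)) by lra; reflexivity.
Qed.

Lemma is_F_unique (s d : nat -> R) (F G : R -> R) :
  is_F s d F -> is_F s d G ->
  forall n theta, theta <= s n -> F theta = G theta.
Proof.
intros [F1 F2 F3] [G1 G2 G3].
induction n as [|n IH]; intros theta H; [rewrite F1, G1; auto|].
destruct (Rle_dec theta (s n)); [auto|].
destruct n as [|n].
- rewrite F2, G2; auto; lra.
- rewrite (F3 (S n)), (G3 (S n)), (IH (s (S n))); auto; try lia; lra.
Qed.

(* Main.v *)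
From Stdlib Require Import Reals Lra Lia.
From Coquelicot Require Import Coquelicot.
Require Import Defs.
Open Scope R_scope.

(** The Barzilai-Borwein iterates are exactly the knots of [F].  Each block of
    [F] is affine near both of its ends, with slopes chosen so that consecutive
    blocks join into one affine function around the common knot; hence
    [Derive F] is [- d j] at the knot [s j] ([is_derive_F_knot]).  With knots
    [m0 * j] and slopes [- / 2 ^ j], if two successive iterates are the knots
    [k] and [k + 1], the secant quotient of the gradient turns the next step
    into [m0 * d (k+1) / (d k - d (k+1))], which is [m0] because the slopes
    halve: the next iterate is the knot [k + 2].

    Although every gradient seen by the method is negative, so that each step
    looks like a descent step, [F] climbs between the knots: over a block of
    length [m] with end slopes [- d] and [- delta] it gains
    [m * (22 + d ^ 2 + delta ^ 2 - 4 * d - 4 * delta) / 32], which is at least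
    [7 / 16 * m] whatever the slopes in [(0, 1]] ([f_end_ge]).  The blocks all
    have length [m0], so [F] grows at least linearly along the iterates. *)

Lemma f_initial_piece (m d delta theta : R) :
  theta < (2 - d) / 16 * m -> f m d delta theta = - d * theta.
Proof.
intros H; unfold f.
destruct (Rlt_dec theta ((2 - d) / 16 * m)); [reflexivity | lra].
Qed.

Lemma f_final_piece (m d delta theta : R) :
  0 < m -> 0 < d -> 0 < delta -> (delta + 14) / 16 * m <= theta ->
  f m d delta theta
  = - delta * theta
    + m * ((22 + d ^ 2 + delta ^ 2 - 4 * d + 28 * delta) / 32).
Proof.
intros Hm Hd Hdelta H.
assert (Hdm : 0 < d * m) by (apply Rmult_lt_0_compat; assumption).
assert (Hem : 0 < delta * m) by (apply Rmult_lt_0_compat; assumption).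
unfold f.
destruct (Rlt_dec theta ((2 - d) / 16 * m)); [lra|].
destruct (Rle_dec theta (3 / 16 * m)); [lra|].
destruct (Rlt_dec theta (1 / 2 * m)); [lra|].
destruct (Rle_dec theta (1 / 2 * m)); [lra|].
destruct (Rlt_dec theta (13 / 16 * m)); [lra|].
destruct (Rlt_dec theta ((delta + 14) / 16 * m)); [lra | reflexivity].
Qed.

(** Completing squares, [22 + d ^ 2 + delta ^ 2 - 4 * d - 4 * delta] equals
    [14 + (d - 2) ^ 2 + (delta - 2) ^ 2]. *)
Lemma f_end_ge (m d delta : R) :
  0 < m -> 0 < d -> 0 < delta <= 1 -> 7 / 16 * m <= f m d delta m.
Proof.
intros Hm Hd Hdelta.
rewrite f_final_piece by nra.
assert (0 <= m * ((d - 2) ^ 2 + (delta - 2) ^ 2)).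
{ apply Rmult_le_pos; [lra|].
  generalize (pow2_ge_0 (d - 2)) (pow2_ge_0 (delta - 2)); lra. }
nra.
Qed.

Section Knots.

Variables (s d : nat -> R) (F : R -> R).
Hypothesis s_incr : forall j, s j < s (S j).
Hypothesis d_range : forall j, 0 < d j <= 1.
Hypothesis F_spec : is_F s d F.

(** Since [F (s 0) = 0], the first block obeys the same recursion as the later
    ones, which avoids treating it separately below. *)
Lemma F_block (j : nat) (theta : R) :
  s j < theta <= s (S j) ->
  F theta = f (s (S j) - s j) (d j) (d (S j)) (theta - s j) + F (s j).
Proof.
intros H; destruct j as [|j].
- rewrite (is_F_first _ _ _ F_spec) by exact H.
  rewrite (is_F_left _ _ _ F_spec (s 0%nat)) by apply Rle_refl; ring.
- apply (is_F_next _ _ _ F_spec); [lia | exact H].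
Qed.

Lemma F_knot_succ_ge (j : nat) :
  F (s j) + 7 / 16 * (s (S j) - s j) <= F (s (S j)).
Proof.
generalize (s_incr j) (d_range j) (d_range (S j)); intros Hs Hd Hd'.
rewrite (F_block j (s (S j))) by lra.
generalize (f_end_ge (s (S j) - s j) (d j) (d (S j))); lra.
Qed.

Lemma F_affine_right_of_knot (j : nat) (theta : R) :
  s j <= theta < s j + (s (S j) - s j) / 16 ->
  F theta = - d j * (theta - s j) + F (s j).
Proof.
intros [[H1 | <-] H2]; [|ring].
generalize (s_incr j) (d_range j); intros Hs Hd.
rewrite (F_block j) by lra.
rewrite f_initial_piece by nra; reflexivity.
Qed.

Lemma F_affine_left_of_knot (j : nat) (theta : R) :
  s (S j) - (s (S j) - s j) / 16 < theta <= s (S j) ->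
  F theta = - d (S j) * (theta - s (S j)) + F (s (S j)).
Proof.
intros H.
generalize (s_incr j) (d_range j) (d_range (S j)); intros Hs Hd Hd'.
rewrite (F_block j theta), (F_block j (s (S j))) by lra.
rewrite !f_final_piece by nra; ring.
Qed.

(** [F] is a single affine function on a neighbourhood of each knot, the pieces
    on its two sides having the same slope. *)
Lemma is_derive_F_knot (j : nat) : is_derive F (s j) (- d j).
Proof.
apply (is_derive_ext_loc (fun theta => - d j * (theta - s j) + F (s j))).
- assert (Hleft : exists e, 0 < e /\ forall theta, s j - e < theta <= s j ->
    F theta = - d j * (theta - s j) + F (s j)).
  { destruct j as [|j].
    - exists 1; split; [lra | intros theta H].
      rewrite !(is_F_left _ _ _ F_spec) by lra; ring.
    - exists ((s (S j) - s j) / 16); split; [generalize (s_incr j); lra|].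
      apply F_affine_left_of_knot. }
  destruct Hleft as [e [He Hleft]].
  assert (He' : 0 < Rmin e ((s (S j) - s j) / 16))
    by (apply Rmin_glb_lt; [|generalize (s_incr j)]; lra).
  exists (mkposreal _ He'); intros y Hy.
  change (Rabs (y - s j) < Rmin e ((s (S j) - s j) / 16)) in Hy.
  generalize (Rmin_l e ((s (S j) - s j) / 16))
    (Rmin_r e ((s (S j) - s j) / 16)); intros Hl Hr.
  apply Rabs_lt_between in Hy; symmetry.
  destruct (Rle_dec y (s j)).
  + apply Hleft; lra.
  + apply F_affine_right_of_knot; lra.
- auto_derive; [trivial | ring].
Qed.

End Knots.

Theorem proposition3p4 (m0 : R) (F : R -> R) (theta : nat -> R) :
  0 < m0 ->
  is_F (fun j => m0 * INR j) (fun j => / 2 ^ j) F ->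
  theta 0%nat = 0 ->
  theta 1%nat = theta 0%nat - m0 * Derive F (theta 0%nat) ->
  (forall k : nat, (1 <= k)%nat ->
    theta (S k) = theta k
      - (theta k - theta (k - 1)%nat)
        / (Derive F (theta k) - Derive F (theta (k - 1)%nat))
        * Derive F (theta k)) ->
  is_lim_seq (fun k => F (theta k)) p_infty.
Proof.
intros Hm HF H0 H1 Hstep.
assert (Hs : forall j, m0 * INR j < m0 * INR (S j))
  by (intros j; rewrite S_INR; lra).
assert (Hd : forall j, 0 < / 2 ^ j <= 1).
{ intros j; split; [apply Rinv_0_lt_compat, pow_lt; lra|].
  rewrite <- Rinv_1; apply Rinv_le_contravar; [lra | apply pow_R1_Rle; lra]. }
assert (HD : forall j, Derive F (m0 * INR j) = - / 2 ^ j)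
  by (intros j; apply is_derive_unique;
      exact (is_derive_F_knot _ _ _ Hs Hd HF j)).
assert (Hknot : forall k,
  theta k = m0 * INR k /\ theta (S k) = m0 * INR (S k)).
{ induction k as [|k [IH IH']].
  - assert (E0 : theta 0%nat = m0 * INR 0) by (rewrite H0; simpl; ring).
    split; [exact E0|].
    rewrite H1, E0, HD; simpl; field.
  - split; [exact IH'|].
    rewrite Hstep by lia.
    replace (S k - 1)%nat with k by lia.
    rewrite IH, IH', !HD, !S_INR; simpl pow.
    assert (Hp : 2 ^ k <> 0) by (apply pow_nonzero; lra).
    (* The slopes halve, so their difference is again the smaller slope. *)
    replace (- / (2 * 2 ^ k) - - / 2 ^ k) with (/ (2 * 2 ^ k))
      by (field; exact Hp).
    field; exact Hp. }
assert (Hgrow : forall k, 7 / 16 * m0 * INR k <= F (theta k)).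
{ intros k; rewrite (proj1 (Hknot k)); induction k as [|k IH].
  - rewrite (is_F_left _ _ _ HF) by (simpl; lra); simpl; lra.
  - generalize (F_knot_succ_ge _ _ _ Hs Hd HF k); cbv beta.
    rewrite S_INR; lra. }
apply (is_lim_seq_le_p_loc (fun k => 7 / 16 * m0 * INR k)).
- exists 0%nat; intros k _; apply Hgrow.
- replace p_infty with (Rbar_mult (7 / 16 * m0) p_infty).
  + apply is_lim_seq_scal_l, is_lim_seq_INR.
  + apply is_Rbar_mult_unique, is_Rbar_mult_sym, is_Rbar_mult_p_infty_pos.
    simpl; lra.
Qed.
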